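(* Let $\alpha<0$ and $\beta<0$ be real numbers. Then $$\lfloor \alpha \lfloor \beta x\rfloor\rfloor \ \ge\ \lfloor \beta \lfloor \alpha x\rfloor\rfloor \quad\text{for all } x\in\mathbb{R}$$ holds if and only if at least one of the following conditions holds: (i) there are integers $m\ge 0$, $n\ge 1$ such that $m\alpha\beta - n\beta = -\alpha$; (ii) there are coprime integers $p,q\ge 1$ such that $\alpha=-\frac{q}{p}$ and $-\frac1p\le \beta<0$; (iii* ) there are coprime integers $p,q\ge 1$ and integers $m\ge 0$, $n\ge 1$, $r\ge 1$ such that $$\alpha=-\frac{q}{p},\qquad \beta=-\frac1p\left(1+\frac1r\left(\frac mp+\frac nq-1\right)\right)^{-1}.$$
   Context: $\lfloor x\rfloor$ denotes the floor function (largest integer $\le x$). *)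

(* Defs.v *)
From mathcomp Require Import all_boot all_order all_algebra.
From mathcomp Require Import reals.

(* Main.v *)
(* Put a = - alpha and b = - beta.  The inequality says that every nonempty interval
   [a i, k) with integer i, k contains a multiple of b; equivalently, the plane subgroup
   G = {(k - a i, b j - a i)} avoids the triangle 0 < x <= y < b.
   If the first coordinates of G are dense, two independent short vectors of G would
   generate a lattice meeting the triangle, so G lies in the lines y = c x + b Z with
   0 <= c < 1; the points (1, 0) and (a, a) then give c = m b and (1 - c) a = n b.
   Otherwise a = q / p and the first coordinates form (1 / p) Z.  If b > 1 / p, the fibre
   of G over 0 must be discrete, say D Z with b = r D and q = e D, and the largest y < b in
   the fibre over 1 / p is below 1 / p; this last inequality amounts to
   e = (r - 1) p q + m q + n p with m >= 0 and n >= 1. *)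
Require Import Defs.
From mathcomp Require Import all_boot all_order all_algebra.
From mathcomp Require Import boolp reals ring lra.
Import Order.TTheory GRing.Theory Num.Theory.
Local Open Scope ring_scope.

(** * Rounding to integers and to multiples of a positive real *)

Lemma floor_bounds (R : realType) (x : R) :
  (Num.floor x)%:~R <= x < (Num.floor x)%:~R + 1.
Proof. by rewrite floor_le -[X in _ + X]/(1%:~R) -intrD floorD1_gt. Qed.

Lemma int_lt_le_succ (R : realType) (m n : int) :
  (m%:~R < n%:~R :> R) -> m%:~R + 1 <= n%:~R :> R.
Proof. by rewrite ltr_int -[X in _ + X]/(1%:~R) -intrD ler_int lezD1. Qed.

Lemma floor_div_bounds (R : realType) (x d : R) : 0 < d ->
  (Num.floor (x / d))%:~R * d <= x < (Num.floor (x / d))%:~R * d + d.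
Proof.
move=> d0; have := floor_bounds _ (x / d).
by rewrite ler_pdivlMr // ltr_pdivrMr // mulrDl mul1r.
Qed.

(** * Subgroups of the line and of the plane *)

(** If every positive element is at least [e], passing from [z] to a smaller positive [z'] loses at
    least [e], because [z - z'] lies in [H]. The descent stops at a least positive element, and
    division with remainder shows that it generates [H]. *)
Lemma subgroup_dense_or_cyclic (R : realType) (H : R -> Prop) (z0 : R) :
  (forall x y (s t : int), H x -> H y -> H (s%:~R * x + t%:~R * y)) ->
  H z0 -> 0 < z0 ->
  (forall e, 0 < e -> exists2 z, H z & 0 < z < e) \/
  (exists d, [/\ 0 < d, H d & forall z, H z -> exists n : int, z = n%:~R * d]).
Proof.
move=> HH Hz0 z0_gt0.
case: (EM (forall e, 0 < e -> exists2 z, H z & 0 < z < e)); first by left.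
move=> /existsNP [e /not_implyP [e0 He]]; right.
have Hge z : H z -> 0 < z -> e <= z.
  by move=> Hz z_gt0; rewrite leNgt; apply/negP => ze; apply: He; exists z; rewrite ?z_gt0.
have [n] : exists n : nat, z0 < n%:R * e.
  exists (Num.truncn (z0 / e)).+1; rewrite -ltr_pdivrMr //.
  by apply: truncnS_gt.
elim: n z0 Hz0 z0_gt0 => [|n IH] z Hz z_gt0 z_lt; first by lra.
case: (EM (exists2 z', H z' & 0 < z' < z)) => [[z' Hz' /andP[z'0 z'z]]|Hmin].
  apply: (IH z') => //.
  have: H (1%:~R * z + (-1)%:~R * z') by apply: HH.
  rewrite mulrN1z mulr1z mul1r mulN1r => /Hge; rewrite subr_gt0 => /(_ z'z) h.
  by move: z_lt; rewrite -natr1 mulrDl mul1r; lra.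
exists z; split=> // y Hy; exists (Num.floor (y / z)).
have /andP[h1 h2] := floor_div_bounds _ y z z_gt0.
apply/eqP; rewrite eq_le h1 andbT leNgt; apply/negP => h3; apply: Hmin.
exists (1%:~R * y + (- Num.floor (y / z))%:~R * z); first exact: HH.
by rewrite mulrNz; apply/andP; split; lra.
Qed.

(* Two independent short vectors generate a lattice fine enough to meet the
   triangle, so all short vectors share one slope c. *)
Lemma plane_subgroup_avoiding_triangle (R : realType) (G : R -> R -> Prop) (b : R) :
  (forall x y x' y' (s t : int), G x y -> G x' y' ->
     G (s%:~R * x + t%:~R * x') (s%:~R * y + t%:~R * y')) ->
  0 < b -> G 0 b ->
  (forall x y, G x y -> 0 < x -> x <= y -> y < b -> False) ->
  (forall e, 0 < e -> exists x y, G x y /\ 0 < x < e) ->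
  exists2 c, 0 <= c < 1 &
    forall x y, G x y -> exists l : int, y - c * x = l%:~R * b.
Proof.
move=> GG b0 Gb Gtri Gdense.
(* Translating by multiples of [(0, b)] brings [y] into [0, b); the triangle excludes [x, b), which
   leaves [0, x). *)
have reduce x y : G x y -> 0 < x < b -> exists2 l : int,
    G x (y - l%:~R * b) & 0 <= y - l%:~R * b < x.
  move=> Gxy /andP[x0 xb].
  have := GG _ _ _ _ 1 (- Num.floor (y / b)) Gxy Gb.
  rewrite mulr0 addr0 !mul1r mulrNz mulNr => Gxl.
  exists (Num.floor (y / b)) => //.
  have /andP[h1 h2] := floor_div_bounds _ y b b0.
  rewrite subr_ge0 h1 /= ltNge; apply/negP => h3.
  by apply: (Gtri x (y - (Num.floor (y / b))%:~R * b)) => //; lra.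
have collinear x y x' y' : G x y -> G x' y' -> 0 < x < b / 12%:R ->
    0 < x' < b / 12%:R -> 0 <= y < x -> 0 <= y' < x' -> x * y' = x' * y.
  move=> Gxy Gxy' hx hx' hy hy'; apply: contrapT => /eqP; rewrite -subr_eq0.
  set D := _ - _ => D0.
  (* Cramer's rule: [s] and [t] are the coordinates of (b/3, 2b/3) in the two vectors. Rounding them
     down lowers each entry by less than 2 b/12 = b/6, so the resulting point of [G] is still in the
     triangle. *)
  pose s := ((b / 3%:R) * y' - (2%:R * b / 3%:R) * x') / D.
  pose t := (x * (2%:R * b / 3%:R) - y * (b / 3%:R)) / D.
  have e1 : s * x + t * x' = b / 3%:R by rewrite /s /t /D; field; exact: D0.
  have e2 : s * y + t * y' = 2%:R * b / 3%:R by rewrite /s /t /D; field; exact: D0.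
  have /andP[s1 s2] := floor_bounds _ s; have /andP[t1 t2] := floor_bounds _ t.
  have := GG _ _ _ _ (Num.floor s) (Num.floor t) Gxy Gxy'.
  set u := (Num.floor s)%:~R in s1 s2 *; set v := (Num.floor t)%:~R in t1 t2 *.
  have frac (r w z : R) : w <= r -> r < w + 1 -> 0 <= z -> w * z <= r * z <= w * z + z.
    by move=> *; apply/andP; split; nra.
  have := frac _ _ x s1 s2; have := frac _ _ y s1 s2.
  have := frac _ _ x' t1 t2; have := frac _ _ y' t1 t2.
  move: hx hx' hy hy' => /andP[? ?] /andP[? ?] /andP[? ?] /andP[? ?].
  move=> /(_ ltac:(lra))/andP[? ?] /(_ ltac:(lra))/andP[? ?].
  move=> /(_ ltac:(lra))/andP[? ?] /(_ ltac:(lra))/andP[? ?].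
  by move=> /Gtri; apply; lra.
have b12 : 0 < b / 12%:R by lra.
have [x0 [y0 [G0 hx0]]] := Gdense _ b12.
have /andP[x0_gt0 x0_lt] := hx0.
have [l0 Gl0 hl0] := reduce _ _ G0 ltac:(apply/andP; split; lra).
set y1 := _ - _ in Gl0 hl0; have /andP[y1_ge0 y1_lt] := hl0.
exists (y1 / x0); first by rewrite divr_ge0 ?(ltW x0_gt0) //= ltr_pdivrMr // mul1r.
move=> x y Gxy.
(* Rounding this way puts the remainder x - n x0 in the interval (0, x0]. *)
pose n : int := - Num.floor (- x / x0) - 1.
have := floor_div_bounds _ (- x) x0 x0_gt0.
have <- : - n%:~R - 1 = (Num.floor (- x / x0))%:~R :> R.
  by rewrite /n intrB mulrNz mulr1z; ring.
move=> /andP[h1 h2].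
have := GG _ _ _ _ 1 (- n) Gxy Gl0.
rewrite mulrNz mulr1z !mul1r => /reduce; case; first by apply/andP; split; lra.
move=> l Gl hl; exists l.
have h := collinear _ _ _ _ Gl0 Gl hx0 ltac:(apply/andP; split; lra) hl0 hl.
have x0n : x0 != 0 by rewrite gt_eqF.
apply: (mulfI x0n).
have -> : x0 * (y - y1 / x0 * x) = x0 * y - y1 * x by field.
lra.
Qed.

(** * The floor inequality as a statement about multiples of [b] *)

Definition multiples_interlace (R : realType) (a b : R) :=
  forall i k : int, a * i%:~R < k%:~R ->
  exists j : int, a * i%:~R <= b * j%:~R < k%:~R.

(** If the largest multiple of [b] below [k] also lies below [a i], then [a i, k) falls into the gap
    before the next multiple; only such gaps have to be excluded. *)
Lemma interlace_of_consecutive (R : realType) (a b : R) : 0 < b ->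
  (forall i j k : int, b * j%:~R < a * i%:~R -> a * i%:~R < k%:~R ->
     k%:~R <= b * (j%:~R + 1) -> False) ->
  multiples_interlace R a b.
Proof.
move=> b0 H i k aik.
(* Negating before the floor makes the rounding strict: [j = - l - 1] satisfies b j < k <= b (j +
   1), even when [k] is a multiple of [b]. *)
pose l := Num.floor (- k%:~R / b).
have /andP[l1 l2] := floor_div_bounds _ (- k%:~R) b b0.
exists (- l - 1); rewrite intrB mulrNz mulr1z.
apply/andP; split; last by rewrite /l; lra.
rewrite leNgt; apply/negP => lt_l.
by apply: (H i (- l - 1) k); rewrite ?intrB ?mulrNz ?mulr1z // /l; lra.
Qed.

Lemma floor_commutator_interlace (R : realType) (a b : R) : 0 < a -> 0 < b ->
  (forall x : R,
     Num.floor (- b * (Num.floor (- a * x))%:~R)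
       <= Num.floor (- a * (Num.floor (- b * x))%:~R))
  <-> multiples_interlace R a b.
Proof.
move=> a0 b0; split=> [Hx|Hik x].
  apply: interlace_of_consecutive => // i j k bjai aik kbj.
  (* At x = i / b the inner floor of [- b x] is exactly [- i], so the right side is floor (a i) < k,
     while the gap forces the left side to be at least [k]. *)
  have := Hx (i%:~R / b).
  have -> : - b * (i%:~R / b) = (- i)%:~R by rewrite mulrNz; field; rewrite gt_eqF.
  rewrite intrKfloor mulrNz mulrNN; apply/negP; rewrite -ltNge.
  have fk : Num.floor (a * i%:~R) < k.
    by rewrite -(ltr_int R); apply: le_lt_trans aik; exact: floor_le.
  apply: (lt_le_trans fk); rewrite floor_ge_int.
  set J := Num.floor _.
  have : J%:~R < (- j)%:~R :> R.
    apply: (le_lt_trans (floor_le _)).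
    have -> : - a * (i%:~R / b) = - (a * i%:~R) / b by ring.
    by rewrite ltr_pdivrMr // mulrNz; lra.
  by move=> /int_lt_le_succ; rewrite mulrNz -(ler_pM2l b0); lra.
set I := Num.floor (- b * x); set J := Num.floor (- a * x).
set k := Num.floor (- b * J%:~R).
rewrite leNgt; apply/negP => ltk.
have aIk : a * (- I)%:~R < k%:~R.
  have /andP[_] := floor_bounds _ (- a * I%:~R).
  by move: ltk; rewrite -(ltr_int R) => /int_lt_le_succ; rewrite mulrNz; lra.
have /andP[I1 I2] := floor_bounds _ (- b * x).
have /andP[J1 J2] := floor_bounds _ (- a * x).
have /andP[k1 k2] := floor_bounds _ (- b * J%:~R).
have [j] := Hik _ _ aIk; rewrite mulrNz => /andP[j1 j2].
have : b * j%:~R < b * (- J)%:~R by rewrite mulrNz; rewrite -/k in k1; lra.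
rewrite ltr_pM2l // => /int_lt_le_succ; rewrite mulrNz => jJ.
rewrite -/I -/J in I1 I2 J1 J2.
(* The contradiction is the cycle a b x <= - a I <= b j <= b (- J - 1) < a b x. *)
have : a * (b * x) <= a * (- I%:~R) by rewrite ler_pM2l //; lra.
have : b * (j%:~R + 1) <= b * (- J%:~R) by rewrite ler_pM2l //.
have : b * (- J%:~R - 1) < b * (a * x) by rewrite ltr_pM2l //; lra.
lra.
Qed.

(** Interlacing gives a multiple of [b] in [a i, k); being below [b j], it is at most b j - b, which
    is less than [a i]. *)
Lemma interlace_avoids_triangle (R : realType) (a b : R) (i j k : int) : 0 < b ->
  multiples_interlace R a b ->
  0 < k%:~R - a * i%:~R ->
  k%:~R - a * i%:~R <= b * j%:~R - a * i%:~R ->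
  b * j%:~R - a * i%:~R < b -> False.
Proof.
move=> b0 Hik h1 h2 h3; have [|l /andP[l1 l2]] := Hik i k; first lra.
have : b * l%:~R < b * j%:~R by lra.
rewrite ltr_pM2l // => /int_lt_le_succ; rewrite -(ler_pM2l b0); lra.
Qed.

(** * Sufficiency of each of the three conditions *)

(** In a gap b j < a i < k <= b (j + 1), expanding [a i] by the relation gives j < n i + m k, hence
    j + 1 <= n i + m k. Multiplying k <= b (j + 1) by [a] and expanding [a k] then yields n b k <= n
    b a i, against a i < k. *)
Lemma interlace_linear (R : realType) (a b : R) (m n : int) :
  0 < a -> 0 < b -> 0 <= m -> 1 <= n ->
  a = m%:~R * a * b + n%:~R * b ->
  multiples_interlace R a b.
Proof.
rewrite -(ler_int R 0) -(ler_int R 1) => a0 b0 m0 n0 ab.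
apply: interlace_of_consecutive => // i j k h1 h2 h3.
have h4 : (j - n * i)%:~R < (m * k)%:~R :> R.
  rewrite intrB !intrM -(ltr_pM2l b0).
  have : b * (m%:~R * (a * i%:~R)) <= b * (m%:~R * k%:~R).
    by rewrite ler_pM2l // ler_wpM2l // ltW.
  have -> : b * (m%:~R * (a * i%:~R)) = (a - n%:~R * b) * i%:~R by rewrite {2}ab; ring.
  lra.
have := int_lt_le_succ _ _ _ h4; rewrite intrB !intrM => h5.
have h6 : a * k%:~R <= a * (b * (n%:~R * i%:~R + m%:~R * k%:~R)).
  rewrite ler_pM2l //; apply: (le_trans h3); rewrite ler_pM2l //; lra.
have : (n%:~R * b) * (a * i%:~R) < (n%:~R * b) * k%:~R.
  by rewrite ltr_pM2l // mulr_gt0 //; lra.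
have : a * k%:~R = (m%:~R * a * b + n%:~R * b) * k%:~R by rewrite -ab.
lra.
Qed.

(** A positive k - a i is a multiple of 1 / p, hence at least [b], too long for a gap between
    consecutive multiples of [b]. *)
Lemma interlace_small (R : realType) (p q : int) (b : R) :
  0 < b -> 1 <= p -> b <= 1 / p%:~R ->
  multiples_interlace R (q%:~R / p%:~R) b.
Proof.
rewrite -(ler_int R 1) => b0 p1 bp.
have p0 : 0 < p%:~R :> R by lra.
apply: interlace_of_consecutive => // i j k h1 h2 h3.
have : (q * i)%:~R < (k * p)%:~R :> R.
  by rewrite !intrM -ltr_pdivrMr // mulrAC.
move=> /int_lt_le_succ; rewrite !intrM => h4.
have : q%:~R / p%:~R * i%:~R + 1 / p%:~R <= k%:~R :> R.
  by rewrite mulrAC -mulrDl ler_pdivrMr.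
lra.
Qed.

(** The equation is the third condition with denominators cleared, for b = - beta. *)
Lemma interlace_sporadic (R : realType) (p q m n r : int) (b : R) :
  0 < b -> 1 <= p -> 1 <= q -> 0 <= m -> 1 <= n -> 1 <= r ->
  r%:~R * q%:~R = b * ((r%:~R - 1) * p%:~R * q%:~R + m%:~R * q%:~R + n%:~R * p%:~R) ->
  multiples_interlace R (q%:~R / p%:~R) b.
Proof.
rewrite -!(ler_int R 1) -(ler_int R 0) => b0 p1 q1 m0 n1 r1.
set E := (_ + _ + _) => Eb.
have p0 : 0 < p%:~R :> R by lra.
have q0 : 0 < q%:~R :> R by lra.
apply: interlace_of_consecutive => // i j k h1 h2 h3.
have qi : q%:~R / p%:~R * i%:~R = q%:~R * i%:~R / p%:~R :> R by rewrite mulrAC.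
have : (q * i)%:~R < (k * p)%:~R :> R by rewrite !intrM -ltr_pdivrMr // -qi.
move=> /int_lt_le_succ; rewrite !intrM => h4.
have E0 : 0 < E.
  have : 0 < r%:~R * q%:~R :> R by apply: mulr_gt0; lra.
  by rewrite Eb pmulr_rgt0.
(* With d = k p - q i >= 1, multiplying both bounds on j by r / b leaves the integer M
   strictly between r j and r j + 1. *)
pose M : int := m * k + n * i + (r - 1) * q * i.
have hj : r%:~R * p%:~R * j%:~R < E * i%:~R.
  rewrite -(ltr_pM2l q0).
  have -> : q%:~R * (r%:~R * p%:~R * j%:~R) = E * p%:~R * (b * j%:~R) :> R.
    have -> : q%:~R * (r%:~R * p%:~R * j%:~R) = (r%:~R * q%:~R) * p%:~R * j%:~R :> R by ring.
    by rewrite Eb; ring.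
  have -> : q%:~R * (E * i%:~R) = E * p%:~R * (q%:~R / p%:~R * i%:~R).
    by field; rewrite gt_eqF.
  by rewrite ltr_pM2l // mulr_gt0.
have hk : E * k%:~R <= r%:~R * q%:~R * (j%:~R + 1).
  have -> : r%:~R * q%:~R * (j%:~R + 1) = E * (b * (j%:~R + 1)) by rewrite Eb; ring.
  by rewrite ler_pM2l.
have hM1 : (r * j)%:~R < M%:~R :> R.
  rewrite /M !(intrD, intrM, mulrNz) mulr1z -(ltr_pM2l p0).
  have : m%:~R * (q%:~R * i%:~R + 1) <= m%:~R * (k%:~R * p%:~R) :> R by rewrite ler_wpM2l.
  rewrite /E in hj; lra.
have := int_lt_le_succ _ _ _ hM1; rewrite /M !(intrD, intrM, mulrNz) mulr1z => hM2.
(* With q i + 1 <= k p this gives q (r j + 1) <= q M <= E k - n - (r - 1) q <= q (r j + 1) - n,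
   impossible for n >= 1. *)
have : q%:~R * (r%:~R * j%:~R + 1) <= q%:~R * (m%:~R * k%:~R + n%:~R * i%:~R + (r%:~R - 1) * q%:~R * i%:~R) :> R.
  by rewrite ler_pM2l.
have : n%:~R * (q%:~R * i%:~R + 1) <= n%:~R * (k%:~R * p%:~R) :> R by rewrite ler_wpM2l //; lra.
have : (r%:~R - 1) * q%:~R * (q%:~R * i%:~R + 1) <= (r%:~R - 1) * q%:~R * (k%:~R * p%:~R) :> R.
  by rewrite ler_wpM2l // mulr_ge0; lra.
rewrite /E in hk; lra.
Qed.

(** * Necessity: one of the three conditions must hold *)

Lemma interlace_cases (R : realType) (a b : R) : 0 < a -> 0 < b ->
  multiples_interlace R a b ->
  [\/ (exists m n : int, [/\ 0 <= m, 1 <= n & a = m%:~R * a * b + n%:~R * b]),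
      (exists p q : int, [/\ 1 <= p, 1 <= q, coprimez p q,
         a = q%:~R / p%:~R & b <= 1 / p%:~R])
    | (exists p q m n r : int,
         [/\ [/\ 1 <= p, 1 <= q & coprimez p q],
             [/\ 0 <= m, 1 <= n & 1 <= r],
             a = q%:~R / p%:~R
           & r%:~R * q%:~R = b * ((r%:~R - 1) * p%:~R * q%:~R
                                  + m%:~R * q%:~R + n%:~R * p%:~R)])].
Proof.
move=> a0 b0 Hik.
have int_ge1 (z : int) : 0 < z%:~R :> R -> 1 <= z by rewrite ltr0z gtz0_ge1.
pose G (x y : R) := exists i j k : int,
  x = k%:~R - a * i%:~R /\ y = b * j%:~R - a * i%:~R.
have GG x y x' y' (s t : int) : G x y -> G x' y' ->
    G (s%:~R * x + t%:~R * x') (s%:~R * y + t%:~R * y').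
  move=> [i [j [k [-> ->]]]] [i' [j' [k' [-> ->]]]].
  exists (s * i + t * i'), (s * j + t * j'), (s * k + t * k').
  by rewrite !intrD !intrM; split; ring.
have Gb : G 0 b by exists 0, 1, 0; rewrite !mulr0z !mulr1z; split; ring.
have G1 : G 1 0 by exists 0, 0, 1; rewrite !mulr0z !mulr1z; split; ring.
have Ga : G a a by exists (-1), 0, 0; rewrite !mulr0z mulrNz !mulr1z; split; ring.
have Gtri x y : G x y -> 0 < x -> x <= y -> y < b -> False.
  by move=> [i [j [k [-> ->]]]]; exact: interlace_avoids_triangle.
have XH (x x' : R) (s t : int) : (exists y, G x y) -> (exists y, G x' y) ->
    exists y, G (s%:~R * x + t%:~R * x') y.
  by move=> [y Gy] [y' Gy']; exists (s%:~R * y + t%:~R * y'); exact: GG.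
have X1 : exists y, G 1 y by exists 0.
case: (subgroup_dense_or_cyclic R (fun x => exists y, G x y) 1 XH X1 ltr01).
  move=> dense; apply: Or31.
  have [|c /andP[c0 c1] Hc] := plane_subgroup_avoiding_triangle R G b GG b0 Gb Gtri.
    by move=> e /dense [x [y Gxy] xe]; exists x, y.
  have [l hl] := Hc _ _ G1; have [n hn] := Hc _ _ Ga.
  have cl : c = (- l)%:~R * b by rewrite mulrNz; lra.
  exists (- l), n; split.
  - by rewrite -(ler0z R) -(pmulr_lge0 _ b0) -cl.
  - apply: int_ge1; rewrite -(pmulr_lgt0 _ b0) -hn.
    by have : c * a < 1 * a by [rewrite ltr_pM2r]; lra.
  - by rewrite -hn mulrAC -cl; ring.
move=> [d [d0 [y0 Gd] Hd]].
have [p pd] := Hd _ X1; have [q qd] := Hd _ (ex_intro _ a Ga).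
have p0 : 0 < p%:~R :> R by rewrite -(pmulr_lgt0 _ d0) -pd.
have q0 : 0 < q%:~R :> R by rewrite -(pmulr_lgt0 _ d0) -qd.
have pn : p%:~R != 0 :> R := lt0r_neq0 p0.
have dp : d = 1 / p%:~R by apply: (mulfI pn); rewrite -pd; field.
have aqp : a = q%:~R / p%:~R by rewrite qd dp mul1r.
(* The generator [d] = 1 / p is itself a first coordinate k - a i; clearing denominators gives a
   Bezout relation, hence coprimality. *)
have bezout (i k : int) : d = k%:~R - a * i%:~R -> p * k - q * i = 1.
  rewrite dp aqp => h; apply: (intr_inj (R := R)); rewrite intrB !intrM mulr1z.
  transitivity (p%:~R * (1 / p%:~R) : R); last by field.
  by rewrite h; field.
have pq : coprimez p q.
  move: Gd => [i [j [k [/bezout h _]]]].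
  by apply/coprimezP; exists (k, - i) => /=; rewrite -h; ring.
have [bd|db] := leP b d.
  by apply: Or32; exists p, q; split; rewrite ?int_ge1 // -dp.
apply: Or33.
have G0H (y y' : R) (s t : int) : G 0 y -> G 0 y' -> G 0 (s%:~R * y + t%:~R * y').
  by move=> Gy Gy'; have := GG _ _ _ _ s t Gy Gy'; rewrite !mulr0 addr0.
have shift y z (t : int) : G d y -> G 0 z -> G d (y + t%:~R * z).
  by move=> Gy Gz; have := GG _ _ _ _ 1 t Gy Gz; rewrite mulr0 addr0 !mul1r.
case: (subgroup_dense_or_cyclic R (G 0) b G0H Gb b0).
  (* A step [z] shorter than b - d moves [y0] into [d, b), giving a point of the triangle over x =
     d. *)
  move=> dense; have [|z Gz /andP[z0 zbd]] := dense (b - d); first lra.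
  have /andP[h1 h2] := floor_div_bounds _ (y0 - d) z z0.
  exfalso; apply: (Gtri d (y0 + (- Num.floor ((y0 - d) / z))%:~R * z)) => //.
  - exact: shift.
  - by rewrite mulrNz; lra.
  - by rewrite mulrNz; lra.
move=> [D [D0 GD HD]].
have [r rD] := HD _ Gb.
have Gq : G 0 q%:~R.
  exists (- p), 0, (- q); rewrite !mulrNz mulr0z aqp.
  by split; field.
have [e eD] := HD _ Gq.
have r0 : 0 < r%:~R :> R by rewrite -(pmulr_lgt0 _ D0) -rD.
(* The largest y < b in the fibre over x = 1 / p must lie below 1 / p. *)
have /andP[h1 h2] := floor_div_bounds _ (y0 - b) D D0.
have := shift _ _ (- Num.floor ((y0 - b) / D) - 1) Gd GD.
rewrite intrB mulrNz mulr1z.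
set y1 := y0 + _ => Gy1.
have y1b : y1 < b by rewrite /y1; lra.
have y1D : b - D <= y1 by rewrite /y1; lra.
have y1d : y1 < d by rewrite ltNge; apply/negP => ?; apply: (Gtri d y1).
move: Gy1 => [i [j [k [/bezout pkqi y1E]]]].
have pkqiR : p%:~R * k%:~R - q%:~R * i%:~R = 1 :> R.
  by rewrite -!intrM -intrB pkqi mulr1z.
have y1p : p%:~R * y1 = D * (p%:~R * r%:~R * j%:~R - e%:~R * i%:~R).
  by rewrite y1E aqp rD eD; field.
(* These witnesses satisfy D m = p (y1 - (b - D)) and D n = q (d - y1), so their signs express b - D
   <= y1 < d. The Bezout relation makes (r - 1) p q + m q + n p equal to [e], and r q = b e since b
   = r D and q = e D. *)
exists p, q, (p * r * j - i * e - (r - 1) * p), (e * k - q * r * j), r.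
split=> //; first by split=> //; exact: int_ge1.
- split; last exact: int_ge1.
- rewrite -(ler0z R) -(pmulr_rge0 _ D0) !(intrD, intrM, mulrNz) mulr1z.
  have : p%:~R * (b - D) <= p%:~R * y1 by rewrite ler_pM2l.
  by rewrite y1p rD; lra.
- apply: int_ge1; rewrite -(pmulr_rgt0 _ D0) !(intrD, intrM, mulrNz).
  have -> : D * (e%:~R * k%:~R - q%:~R * r%:~R * j%:~R) = q%:~R * (d - y1).
    apply: (mulfI pn).
    have -> : p%:~R * (q%:~R * (d - y1)) =
        q%:~R * (p%:~R * k%:~R - q%:~R * i%:~R) - q%:~R * (p%:~R * y1).
      by rewrite pkqiR dp; field.
    rewrite y1p; transitivity (e%:~R * D * (p%:~R * k%:~R - q%:~R * i%:~R)
        - q%:~R * (D * (p%:~R * r%:~R * j%:~R - e%:~R * i%:~R))); first by ring.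
    by rewrite -eD.
  by rewrite mulr_gt0 // subr_gt0.
- rewrite !(intrD, intrM, mulrNz) mulr1z.
  transitivity (b * (e%:~R * (p%:~R * k%:~R - q%:~R * i%:~R))); last by ring.
  by rewrite pkqiR rD eD; ring.
Qed.

(** * The classification for negative parameters *)

Theorem theorem1p1 (R : realType) (alpha beta : R) (ha : alpha < 0) (hb : beta < 0) :
  (forall x : R,
     Num.floor (alpha * (Num.floor (beta * x))%:~R)
       >= Num.floor (beta * (Num.floor (alpha * x))%:~R))
  <->
  [\/ (exists m n : int,
         [/\ 0 <= m, 1 <= n
           & m%:~R * alpha * beta - n%:~R * beta = - alpha]),
      (exists p q : int,
         [/\ 1 <= p, 1 <= q, coprimez p q,
             alpha = - (q%:~R / p%:~R)
           & - (1 / p%:~R) <= beta < 0])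
    | (exists p q m n r : int,
         [/\ [/\ 1 <= p, 1 <= q & coprimez p q],
             [/\ 0 <= m, 1 <= n & 1 <= r],
             alpha = - (q%:~R / p%:~R)
           & beta = - (1 / p%:~R)
               * (1 + 1 / r%:~R
                    * (m%:~R / p%:~R + n%:~R / q%:~R - 1))^-1])].
Proof.
have a0 : 0 < - alpha by rewrite oppr_gt0.
have b0 : 0 < - beta by rewrite oppr_gt0.
have alphaE (z : R) : - alpha = z -> alpha = - z by move=> <-; rewrite opprK.
have alphaE' (z : R) : alpha = - z -> - alpha = z by move=> ->; rewrite opprK.
have := floor_commutator_interlace R (- alpha) (- beta) a0 b0.
rewrite !opprK => ->; split.
  move=> /(interlace_cases R _ _ a0 b0) [[m [n [m0 n1 h]]]|[p [q [p1 q1 pq h1 h2]]]|].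
  - by apply: Or31; exists m, n; split=> //; rewrite h; ring.
  - apply: Or32; exists p, q; split=> //; first exact: alphaE.
    by rewrite hb andbT lerNl.
  - move=> [p [q [m [n [r [[p1 q1 pq] [m0 n1 r1] h1 h2]]]]]].
    apply: Or33; exists p, q, m, n, r; split=> //; first exact: alphaE.
    move: p1 q1 n1 r1 m0; rewrite -!(ler_int R 1) -(ler_int R 0) => p1 q1 n1 r1 m0.
    rewrite -[LHS]opprK mulNr; congr (- _).
    set E := _ + _ in h2.
    have rq0 : 0 < r%:~R * q%:~R :> R by apply: mulr_gt0; lra.
    (* Here [E] is nonzero because its product with [- beta] is r q > 0. *)
    have En : E != 0 by apply: contraTneq rq0 => E0; rewrite h2 E0 mulr0 ltxx.
    have bE : - beta = r%:~R * q%:~R / E by rewrite h2 mulfK.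
    have [pn qn rn] : [/\ p%:~R != 0 :> R, q%:~R != 0 :> R & r%:~R != 0 :> R].
      by split; rewrite gt_eqF //; lra.
    have -> : 1 + 1 / r%:~R * (m%:~R / p%:~R + n%:~R / q%:~R - 1)
              = E / (r%:~R * p%:~R * q%:~R) :> R.
      by rewrite /E; field; rewrite ?pn ?qn ?rn.
    by rewrite bE; field; rewrite ?En ?pn ?qn ?rn.
case=> [[m [n [m0 n1 h]]]|[p [q [p1 q1 pq /alphaE' -> /andP[h2 _]]]]|].
- by apply: (interlace_linear R _ _ m n) => //; rewrite -{1}h; ring.
- by apply: interlace_small => //; rewrite lerNl.
move=> [p [q [m [n [r [[p1 q1 pq] [m0 n1 r1] /alphaE' -> h]]]]]].
apply: (interlace_sporadic R p q m n r) => //.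
move: p1 q1 n1 r1 m0; rewrite -!(ler_int R 1) -(ler_int R 0) => p1 q1 n1 r1 m0.
set E := _ + _.
(* Now [beta] is given by an inverse, which would be 0 at 0, so [E] is shown to be nonzero from the
   signs alone: n p is positive and the other terms are nonnegative. *)
have En : E != 0.
  rewrite gt_eqF // /E ltr_wpDl // ?mulr_gt0 ?addr_ge0 ?mulr_ge0 //; lra.
have [pn qn rn] : [/\ p%:~R != 0 :> R, q%:~R != 0 :> R & r%:~R != 0 :> R].
  by split; rewrite gt_eqF //; lra.
have EE : 1 + 1 / r%:~R * (m%:~R / p%:~R + n%:~R / q%:~R - 1)
          = E / (r%:~R * p%:~R * q%:~R) :> R.
  by rewrite /E; field; rewrite ?pn ?qn ?rn.
by rewrite h EE; field; rewrite ?En ?pn ?qn ?rn.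
Qed.
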